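(* Let $X$ be a nonempty set. A binary operation $F\colon X^2\to X$ is associative (that is, $F(F(xy)z)=F(xF(yz))$ for all $x,y,z\in X$) if and only if there exists an associative $\varepsilon$-standard operation $G\colon X^*\to X\cup\{\varepsilon\}$ such that $F=G_2$.
   Context: $X^*=\bigcup_{n\geqslant 0}X^n$ is the set of all finite strings over $X$ (vectors in $X^n$ are regarded as strings of length $n$), with $X^0=\{\varepsilon\}$, where $\varepsilon$ is the empty string ($\varepsilon\notin X$). Concatenation is denoted by juxtaposition, and $\varepsilon$ is neutral for it. For a function $G$ on $X^*$, $G_n=G|_{X^n}$ is its $n$-ary part. An operation $G\colon X^*\to X\cup\{\varepsilon\}$ is $\varepsilon$-standard if $G(\varepsilon)=\varepsilon$ and $G(\mathbf{x})=\varepsilon$ only if $\mathbf{x}=\varepsilon$ (so $G_n$ maps $X^n$ into $X$ for $n\geqslant 1$). It is associative if $G(\mathbf{x}\mathbf{y}\mathbf{z})=G(\mathbf{x}\,G(\mathbf{y})\,\mathbf{z})$ for all $\mathbf{x},\mathbf{y},\mathbf{z}\in X^*$, where $G(\mathbf{y})\in X\cup\{\varepsilon\}$ is regarded as a string of length at most one. *)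

(* Defs.v *)
From mathcomp Require Import all_boot.

Set Implicit Arguments.
Unset Strict Implicit.
Unset Printing Implicit Defensive.

(* Strings over X are [seq X], with [[::]] the empty string.  The codomain
   X \cup {epsilon} is [option X], with [None] playing the role of epsilon;
   [seq_of_opt] regards its elements as strings of length at most one. *)

Definition eps_standard (X : Type) (G : seq X -> option X) : Prop :=
  G [::] = None /\ forall x : seq X, G x = None -> x = [::].

Definition string_associative (X : Type) (G : seq X -> option X) : Prop :=
  forall x y z : seq X, G (x ++ y ++ z) = G (x ++ seq_of_opt (G y) ++ z).

Definition nary_part (X : Type) (G : seq X -> option X) (n : nat) :
    n.-tuple X -> option X :=
  fun t => G t.

(* Main.v *)
(* Adjoin eps to X as a neutral element for F: when F is associative, this makes
   the option type a monoid, and G is the product of a string in this monoid.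
   Conversely, associativity of G evaluates the string xyz both as F (F x y) z
   and as F x (F y z). *)
Require Import Defs.
From mathcomp Require Import all_boot.

Set Implicit Arguments.
Unset Strict Implicit.
Unset Printing Implicit Defensive.

Definition adjoin_unit (X : Type) (F : X -> X -> X) (u v : option X) :
    option X :=
  match u, v with
  | Some a, Some b => Some (F a b)
  | Some a, None => Some a
  | None, _ => v
  end.

Lemma adjoin_unitA (X : Type) (F : X -> X -> X) :
  associative F -> associative (adjoin_unit F).
Proof. by move=> FA [a|] [b|] [c|] //=; rewrite FA. Qed.

Definition string_prod (X : Type) (F : X -> X -> X) (s : seq X) : option X :=
  foldr (fun a => adjoin_unit F (Some a)) None s.

Lemma string_prod_cat (X : Type) (F : X -> X -> X) (s t : seq X) :
  associative F ->
  string_prod F (s ++ t) = adjoin_unit F (string_prod F s) (string_prod F t).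
Proof.
move=> FA; elim: s => [//|a s IHs].
rewrite -[LHS]/(adjoin_unit F (Some a) (string_prod F (s ++ t))) IHs.
exact: adjoin_unitA.
Qed.

Lemma string_prod_opt (X : Type) (F : X -> X -> X) (u : option X) :
  string_prod F (seq_of_opt u) = u.
Proof. by case: u. Qed.

(** Both sides split into three factors; the middle ones agree since an element of [option X], read
    as a string, is its own product. *)
Lemma string_prod_associative (X : Type) (F : X -> X -> X) :
  associative F -> string_associative (string_prod F).
Proof. by move=> FA x y z; rewrite !string_prod_cat // string_prod_opt. Qed.

Lemma string_prod_eps_standard (X : Type) (F : X -> X -> X) :
  eps_standard (string_prod F).
(* Multiplying [Some a] by the product of the tail never gives [None]. *)
Proof. by split=> // -[|a s]; rewrite /string_prod //=; case: (foldr _ _ s). Qed.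

Theorem corollary3p4 (X : Type) (X_nonempty : inhabited X) (F : X -> X -> X) :
  associative F <->
  exists G : seq X -> option X,
    [/\ string_associative G, eps_standard G &
        forall x y : X, nary_part G [tuple x; y] = Some (F x y)].
Proof.
split=> [FA | [G [GA _ G2]] x y z].
  exists (string_prod F); split=> //.
    exact: string_prod_associative.
  exact: string_prod_eps_standard.
have {}G2 a b : G [:: a; b] = Some (F a b) by exact: G2.
(* Contracting the prefix [[:: x; y]], then the suffix [[:: y; z]], gives two values of [G
   [:: x; y; z]]; injectivity of [Some] concludes. *)
have := GA [::] [:: x; y] [:: z]; rewrite G2 /= G2.
by have := GA [:: x] [:: y; z] [::]; rewrite G2 /= G2 => -> [].
Qed.
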